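(* Let $G$ be a noncomplete graph. Then (a) $\overline{e}pa(G) \leq 2$ if and only if there are nonadjacent (distinct) vertices $u,v \in V(G)-V^-(G)$ such that any $\gamma$-set of $G$ contains at most one of them, and (b) $\overline{E}pa(G) = 2$ if and only if $\gamma(G) \geq 2$ and each $\gamma$-set of $G$ is a clique.
   Context: Graphs are finite and simple. $\gamma(H)$ denotes the domination number of a graph $H$; a $\gamma$-set of $H$ is a dominating set of $H$ of cardinality $\gamma(H)$. $V^-(H) = \{x \in V(H) \mid \gamma(H-x) < \gamma(H)\}$. A clique is a set of pairwise adjacent vertices. For distinct vertices $u,v$ of $G$ and an integer $k\geq 0$, $G_{u,v,k}$ denotes the graph obtained from the disjoint union of $G$ and a path $x_0,x_1,\dots,x_{k+1}$ by identifying $u$ with $x_0$ and $v$ with $x_{k+1}$ (so $k$ new vertices are added; for nonadjacent $u,v$, $G_{u,v,0}$ is $G$ with the edge $uv$ added). $pa(u,v)$ is the minimum integer $k\geq 0$ such that $\gamma(G) < \gamma(G_{u,v,k})$. $\overline{e}pa(G)$ and $\overline{E}pa(G)$ are, respectively, the minimum and the maximum of $pa(u,v)$ over all pairs of distinct nonadjacent vertices $u,v$ of $G$. *)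

(* Defs.v *)
From mathcomp Require Import all_boot.

Set Implicit Arguments.
Unset Strict Implicit.
Unset Printing Implicit Defensive.

(* A finite simple graph is a finType V with a symmetric irreflexive
   e : rel V; the definitions below make sense for any relation. *)

Section Domination.
Variables (V : finType) (e : rel V).

Definition nonadjacent (u v : V) : bool := (u != v) && ~~ e u v.

Definition noncomplete : Prop := exists u v : V, nonadjacent u v.

Definition clique (D : {set V}) : Prop :=
  {in D &, forall x y, x != y -> e x y}.

Definition dominating (D : {set V}) : bool :=
  [forall x, (x \in D) || [exists y in D, e y x]].

Definition gamma : nat := #|[arg min_(D < [set: V] | dominating D) #|D|]|.

Definition gamma_set (D : {set V}) : bool := dominating D && (#|D| == gamma).

Lemma dominatingT : dominating [set: V].
Proof. by apply/forallP=> x; rewrite inE. Qed.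

Lemma gamma_le (D : {set V}) : dominating D -> gamma <= #|D|.
Proof.
rewrite /gamma; case: arg_minnP => [|A _ minA]; first exact: dominatingT.
exact: minA.
Qed.

Lemma gamma_setP : exists D, gamma_set D.
Proof.
exists [arg min_(D < [set: V] | dominating D) #|D|]; rewrite /gamma_set eqxx andbT.
by case: arg_minnP => //; exact: dominatingT.
Qed.

End Domination.

Definition del_vertex (V : finType) (e : rel V) (x : V) :
  rel {y : V | y != x} := fun y z => e (val y) (val z).
Arguments del_vertex {V} e x : rename.

Definition Vminus (V : finType) (e : rel V) : {set V} :=
  [set x | gamma (del_vertex e x) < gamma e].

Section AddPath.
Variables (V : finType) (e : rel V) (u v : V).

(* The image of the path vertex x_j (j <= k.+1) once x_0 and x_{k+1} have been
   identified with u and v; the k new vertices x_1, ..., x_k are the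
   inr i with i : 'I_k, x_{i+1} being inr i. *)
Definition path_vertex (k j : nat) : V + 'I_k :=
  if j is i.+1 then (if insub i is Some o then inr o else inl v) else inl u.

(* The edges are those of G and the images of the path edges x_j x_{j+1};
   for k = 0 the only path edge is uv. *)
Definition add_path (k : nat) : rel (V + 'I_k) := fun a b =>
  (if (a, b) is (inl x, inl y) then e x y else false)
  || [exists j : 'I_k.+1,
        ((a == path_vertex k j) && (b == path_vertex k j.+1))
        || ((b == path_vertex k j) && (a == path_vertex k j.+1))].
Arguments add_path k : clear implicits.

Lemma path_vertex_inr k j (i : 'I_k) : path_vertex k j = inr i -> j = i.+1.
Proof. by case: j => //= j; case: insubP => // o _ <- [->]. Qed.

Lemma add_path_inr k (a : V + 'I_k) (i : 'I_k) : 0 < i -> i.+1 < k ->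
  add_path k a (inr i) -> exists2 j : 'I_k, a = inr j & (j == i.+1 :> nat) || (j.+1 == i).
Proof.
move=> i_gt0 ltik; rewrite /add_path.
have -> : (if (a, inr i : V + 'I_k) is (inl x, inl y) then e x y else false) = false.
  by case: a.
case/existsP=> j /orP[] /andP[/eqP Ea /eqP Eb].
  have /path_vertex_inr/eq_add_S Ej := esym Eb.
  move: Ea; rewrite Ej -(prednK i_gt0) /=.
  case: insubP => [o _ Eo ->|/negP[]]; last exact: leq_ltn_trans (leq_pred _) (ltnW ltik).
  by exists o => //; rewrite Eo prednK // eqxx orbT.
have /path_vertex_inr Ej := esym Ea.
move: Eb; rewrite Ej /=.
case: insubP => [o _ Eo ->|/negP[]//].
by exists o => //; rewrite Eo eqxx.
Qed.

Lemma pa_exists : exists k, gamma e < gamma (add_path k).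
Proof.
set n := #|V|.+1; exists (n * 3).
have [D /andP[/forallP domD /eqP <-]] := gamma_setP (add_path (n * 3)).
have le_gn : gamma e < n.
  by rewrite ltnS -cardsT; exact/gamma_le/dominatingT.
apply: leq_trans le_gn _.
pose f (a : V + 'I_(n * 3)) : 'I_n := if a is inr i then inord (i %/ 3) else ord0.
suff /subset_leq_card : [set: 'I_n] \subset f @: D.
  by rewrite cardsT card_ord => /leq_trans; apply; exact: leq_imset_card.
apply/subsetP=> m _.
have lt_m r : r < 3 -> m * 3 + r < n * 3.
  move=> lt_r; apply: (@leq_trans (m.+1 * 3)); last by rewrite leq_mul2r ltn_ord orbT.
  by rewrite mulSn addnC ltn_add2r.
have fE r (lt_r : r < 3) (j : 'I_(n * 3)) : j = m * 3 + r :> nat -> f (inr j) = m.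
  by move=> Ej; apply/val_inj; rewrite /f Ej divnMDl // divn_small // addn0 inord_val.
pose i := Ordinal (lt_m 1 isT).
have lt2 := lt_m 2 isT.
have /orP[iD|/exists_inP[a aD]] := domD (inr i).
  by apply/imsetP; exists (inr i) => //; rewrite (fE 1).
case/add_path_inr; rewrite /= ?addn1 //; first by rewrite -addn2.
move=> j Ea /orP[]/eqP Ej; apply/imsetP; exists a => //; rewrite Ea.
  by rewrite (fE 2) // Ej addn2.
by rewrite (fE 0) // addn0; case: Ej.
Qed.

Definition pa : nat := ex_minn pa_exists.

End AddPath.

Section ExtremalPa.
Variables (V : finType) (e : rel V).

(* Both default to 0 on complete graphs, which have no nonadjacent pair. *)
Definition epa_bar : nat :=
  if [pick p : V * V | nonadjacent e p.1 p.2] is Some p0 then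
    let p := [arg min_(p < p0 | nonadjacent e p.1 p.2) pa e p.1 p.2] in
    pa e p.1 p.2
  else 0.

Definition Epa_bar : nat :=
  \max_(p : V * V | nonadjacent e p.1 p.2) pa e p.1 p.2.

End ExtremalPa.

(* Main.v *)
Require Import Defs.
From mathcomp Require Import all_boot zify.

Set Implicit Arguments.
Unset Strict Implicit.
Unset Printing Implicit Defensive.

(** Two conditions govern [pa u v <= 2].  A dominating set of [G_{u,v,2}] with at
    most [gamma] elements that avoids [x_1] and [x_2] is a [gamma]-set of [G]
    containing [u] and [v]; one that meets [{x_1, x_2}] leaves, possibly after
    trading a path vertex for [u], fewer than [gamma] vertices dominating
    everything but [u] or everything but [v], so that one of them lies in [V^-].
    Conversely either situation also gives such a set in [G_{u,v,1}].  Hence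
    [pa u v <= 2] iff [u] and [v] are outside [V^-] and in no common
    [gamma]-set.  If all [gamma]-sets are cliques and [gamma >= 2], then [V^-] is
    empty, since for [x] in [V^-] some [gamma]-set consists of [x] and nonneighbours
    of [x]; and [pa u v >= 2] as soon as [u] lies in a [gamma]-set. *)

(** * Dominated vertices and undersized sets *)

Section Domination.
Variables (V : finType) (e : rel V).

Definition dominated (D : {set V}) (x : V) : bool :=
  (x \in D) || [exists y in D, e y x].

Lemma dominatedP (D : {set V}) (x : V) :
  reflect (x \in D \/ exists2 y, y \in D & e y x) (dominated D x).
Proof.
apply: (iffP orP) => -[xD|]; try by left.
  by case/exists_inP=> y; right; exists y.
by case=> y yD eyx; right; apply/exists_inP; exists y.
Qed.

Lemma dominatingP (D : {set V}) :
  reflect (forall x, dominated D x) (dominating e D).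
Proof. exact: forallP. Qed.

Lemma dominated_sub (D E : {set V}) (x : V) :
  D \subset E -> dominated D x -> dominated E x.
Proof.
move=> /subsetP sDE /dominatedP[xD|[y yD eyx]]; apply/dominatedP.
  by left; apply: sDE.
by right; exists y => //; apply: sDE.
Qed.

Lemma dominating_gamma_set (D : {set V}) :
  dominating e D -> #|D| <= gamma e -> gamma_set e D.
Proof. by move=> domD leD; rewrite /gamma_set domD eqn_leq leD gamma_le. Qed.

Lemma undominated_of_card_lt (D : {set V}) (x : V) :
  #|D| < gamma e -> (forall y, y != x -> dominated D y) -> ~~ dominated D x.
Proof.
move=> ltD domD; apply/negP=> domx; suff /gamma_le : dominating e D by lia.
by apply/dominatingP=> y; case: (eqVneq y x) => [->|/domD].
Qed.

End Domination.

(** * Vertices whose deletion lowers the domination number *)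

Section Vminus.
Variables (V : finType) (e : rel V).

(** This moves membership in [Vminus] from the subtype to [V] itself: a set with fewer than
    [gamma e] elements dominating all of [G - x] cannot contain [x], so it is a set of vertices of
    [G - x]. *)
Lemma VminusP (x : V) :
  reflect (exists2 D : {set V}, #|D| < gamma e & forall y, y != x -> dominated e D y)
          (x \in Vminus e).
Proof.
rewrite inE; apply: (iffP idP) => [lt_g|[D ltD domD]].
  have [D /andP[/dominatingP domD /eqP cD]] := gamma_setP (del_vertex e x).
  exists (val @: D); first by rewrite card_imset ?cD //; apply: val_inj.
  move=> y yx; have /dominatedP := domD (Sub y yx).
  case=> [yD|[z zD ezy]]; apply/dominatedP.
    by left; apply/imsetP; exists (Sub y yx).
  by right; exists (val z) => //; apply: imset_f.
have /norP[xD _] := undominated_of_card_lt ltD domD.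
apply: leq_ltn_trans ltD.
pose E : {set {y | y != x}} := [set y | val y \in D].
have /gamma_le/leq_trans -> // : dominating (del_vertex e x) E.
  apply/forallP=> y; apply/orP.
  have /dominatedP[yD|[z zD ezy]] := domD (val y) (valP y).
    by left; rewrite inE.
  have zx : z != x by apply: contraNneq xD => <-.
  by right; apply/exists_inP; exists (Sub z zx); rewrite ?inE.
rewrite -(card_imset _ (@val_inj _ _ _)); apply/subset_leq_card/subsetP=> z /imsetP[y].
by rewrite inE => yD ->.
Qed.

(** Adding [x] to the small set from [VminusP] repairs the only gap, at the cost of one vertex. *)
Lemma Vminus_gamma_set (x : V) :
  x \in Vminus e ->
  exists2 D : {set V}, gamma_set e (x |: D) & #|D|.+1 = gamma e /\ ~~ dominated e D x.
Proof.
case/VminusP=> D ltD domD; have ndx := undominated_of_card_lt ltD domD.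
have /norP[xD _] := ndx.
have gD : gamma_set e (x |: D).
  apply: dominating_gamma_set; last by rewrite cardsU1 xD.
  apply/dominatingP=> y; case: (eqVneq y x) => [->|yx].
    by apply/dominatedP; left; rewrite setU11.
  by apply: dominated_sub (domD y yx); apply: subsetUr.
by exists D => //; split=> //; case/andP: gD => _ /eqP <-; rewrite cardsU1 xD.
Qed.

End Vminus.

(** * Adjacency and domination after adding a path *)

Section AddPath.
Variables (V : finType) (e : rel V) (u v : V) (k : nat).

Lemma inr_path_vertex (o : 'I_k) (j : nat) :
  (inr o == path_vertex u v k j) = (j == o.+1).
Proof.
case: j => [|j] //=; case: insubP => [i _ <-|]; first by rewrite eq_sym.
by rewrite eqSS /=; apply: contraNeq => /negPn/eqP ->.
Qed.

(** The bound on [j] is there because [path_vertex] sends every index above [k] to [v]. *)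
Lemma inl_path_vertex (a : V) (j : nat) :
  j <= k.+1 ->
  (inl a == path_vertex u v k j) = (j == 0) && (a == u) || (j == k.+1) && (a == v).
Proof.
case: j => [|j] ltj /=; first by rewrite orbF.
case: insubP => [i ltjk _|]; first by rewrite eqSS ltn_eqF.
by rewrite -leqNgt eqSS => lekj; rewrite eqn_leq lekj andbT (_ : j <= k).
Qed.

Local Arguments path_vertex : simpl never.

Lemma add_path_inl (a b : V) : e a b -> add_path e u v (inl a : V + 'I_k) (inl b).
Proof. by rewrite /add_path => ->. Qed.

Lemma add_path_inlE (a b : V) :
  0 < k -> add_path e u v (inl a : V + 'I_k) (inl b) = e a b.
Proof.
move=> k0; rewrite /add_path; case: (e a b) => //=; apply/existsP=> -[[j ltj]].
by rewrite /= !inl_path_vertex ?(ltnW ltj) //; lia.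
Qed.

Lemma add_path_inl_inr (a : V) (o : 'I_k) :
  add_path e u v (inl a) (inr o) = (o == 0 :> nat) && (a == u) || (o.+1 == k) && (a == v).
Proof.
rewrite /add_path /=; apply/existsP/idP => [[[j ltj]]|].
  rewrite /= !inl_path_vertex ?(ltnW ltj) // !inr_path_vertex.
  have := ltn_ord o; lia.
case/orP=> /andP[/eqP Eo /eqP ->].
  by exists ord0; rewrite inl_path_vertex // inr_path_vertex Eo /= eqxx.
have ltk : o.+1 < k.+1 by rewrite ltnS.
exists (Ordinal ltk).
by rewrite !inr_path_vertex !inl_path_vertex ?(ltnW ltk) //= !eqxx Eo eqxx orbT.
Qed.

Lemma add_path_inr_inl (a : V) (o : 'I_k) :
  add_path e u v (inr o) (inl a) = add_path e u v (inl a) (inr o).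
Proof. by rewrite /add_path; apply: eq_existsb => j; rewrite orbC. Qed.

Lemma add_path_inr_succ (o o' : 'I_k) :
  (o.+1 == o') || (o'.+1 == o) -> add_path e u v (inr o) (inr o').
Proof.
have lt_k1 (i : 'I_k) : i < k.+1 by rewrite ltnW // ltnS.
move=> oo'; apply/existsP; case/orP: oo' => /eqP Eo.
  by exists (Ordinal (lt_k1 o')); rewrite !inr_path_vertex /=; lia.
by exists (Ordinal (lt_k1 o)); rewrite !inr_path_vertex /=; lia.
Qed.

(** All upper bounds on the domination number of $G_{u,v,k}$ below come from this, with [E] empty or
    a single path vertex. *)
Lemma gamma_add_path_le (D : {set V}) (E : {set 'I_k}) :
  (forall x, dominated e D x \/ exists2 o, o \in E & add_path e u v (inr o) (inl x)) ->
  (forall o, [\/ o \in E, exists2 x, x \in D & add_path e u v (inl x) (inr o)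
            | exists2 o', o' \in E & add_path e u v (inr o') (inr o)]) ->
  gamma (add_path e u v (k := k)) <= #|D| + #|E|.
Proof.
move=> domV domP.
pose F : {set V + 'I_k} := (inl @: D) :|: (inr @: E).
have inlF x : x \in D -> inl x \in F by move=> xD; rewrite inE imset_f.
have inrF o : o \in E -> inr o \in F by move=> oE; rewrite inE orbC imset_f.
have /gamma_le/leq_trans -> // : dominating (add_path e u v (k := k)) F.
  apply/dominatingP=> -[x|o]; apply/dominatedP.
    case: (domV x) => [/dominatedP[/inlF|[y /inlF yF eyx]]|[o /inrF oF ox]].
    - by left.
    - by right; exists (inl y) => //; apply: add_path_inl.
    - by right; exists (inr o).
  case: (domP o) => [/inrF|[x /inlF xF xo]|[o' /inrF oF oo]]; first by left.
    by right; exists (inl x).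
  by right; exists (inr o').
apply: leq_trans (leq_card_setU _ _) _.
by rewrite !card_imset // => [x y [] | x y []].
Qed.

(** Restricting to [V] can only lose the domination of [u] by $x_1$ and of [v] by $x_k$. *)
Lemma dominated_add_path (D : {set V + 'I_k}) (x : V) :
  0 < k -> dominated (add_path e u v (k := k)) D (inl x) ->
  dominated e [set y | inl y \in D] x \/
  exists2 o : 'I_k, inr o \in D & (o == 0 :> nat) && (x == u) || (o.+1 == k) && (x == v).
Proof.
move=> k0 /dominatedP[xD|[[y|o] aD]].
- by left; apply/dominatedP; left; rewrite inE.
- rewrite add_path_inlE // => eyx; left; apply/dominatedP.
  by right; exists y; rewrite ?inE.
- by rewrite add_path_inr_inl add_path_inl_inr; right; exists o.
Qed.

End AddPath.

(** * Comparing [pa] with 2 *)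

Section PathAddition.
Variables (V : finType) (e : rel V) (u v : V).

Lemma gamma_add_edge_le : gamma (add_path e u v (k := 0)) <= gamma e.
Proof.
have [D /andP[/dominatingP domD /eqP <-]] := gamma_setP e.
have := @gamma_add_path_le _ e u v 0 D set0; rewrite cards0 addn0; apply.
  by move=> x; left.
by case.
Qed.

Lemma gamma_add_path_common_le (k : nat) (D : {set V}) :
  k <= 2 -> gamma_set e D -> u \in D -> v \in D ->
  gamma (add_path e u v (k := k)) <= gamma e.
Proof.
move=> k2 /andP[/dominatingP domD /eqP <-] uD vD.
have := @gamma_add_path_le _ e u v k D set0; rewrite cards0 addn0; apply.
  by move=> x; left.
move=> o; constructor 2.
have [o0|o0] := eqVneq (o : nat) 0.
  by exists u; rewrite // add_path_inl_inr o0 !eqxx.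
(* As [k <= 2], a path vertex other than $x_1$ is $x_k$, a neighbour of [v]. *)
exists v; rewrite // add_path_inl_inr !eqxx andbT; apply/orP; right.
have := ltn_ord o; lia.
Qed.

Lemma gamma_add_path_Vminus_le (k : nat) :
  0 < k <= 2 -> (u \in Vminus e) || (v \in Vminus e) ->
  gamma (add_path e u v (k := k)) <= gamma e.
Proof.
case/andP=> k0 k2.
(* The path vertex [o] next to [w] dominates [w] and, as there are at most two path vertices, the
   whole new part of the path. *)
suff main (w : V) (o : 'I_k) : w \in Vminus e -> add_path e u v (inr o) (inl w) ->
    gamma (add_path e u v (k := k)) <= gamma e.
  have ltk : k.-1 < k by rewrite prednK.
  case/orP=> wV.
    apply: (main u (Ordinal k0)) => //.
    by rewrite add_path_inr_inl add_path_inl_inr !eqxx.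
  apply: (main v (Ordinal ltk)) => //.
  by rewrite add_path_inr_inl add_path_inl_inr /= prednK // !eqxx orbT.
case/VminusP=> D ltD domD ow.
have := @gamma_add_path_le _ e u v k D [set o]; rewrite cards1 addn1 => le_g.
apply: leq_trans ltD; apply: le_g => [x|o'].
  have [->|/domD] := eqVneq x w; last by left.
  by right; exists o; rewrite ?set11.
have [->|oo'] := eqVneq o' o; first by constructor 1; rewrite set11.
constructor 3; exists o; rewrite ?set11 //; apply: add_path_inr_succ.
have := ltn_ord o; have := ltn_ord o'; move: oo'; rewrite -(inj_eq val_inj) /=; lia.
Qed.

Lemma gamma_add_path1_le (D : {set V}) :
  gamma_set e D -> u \in D -> gamma (add_path e u v (k := 1)) <= gamma e.
Proof.
move=> /andP[/dominatingP domD /eqP <-] uD.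
have := @gamma_add_path_le _ e u v 1 D set0; rewrite cards0 addn0; apply.
  by move=> x; left.
by move=> o; constructor 2; exists u; rewrite // add_path_inl_inr ord1 !eqxx.
Qed.

Lemma gamma_add_path2_gt :
  u \notin Vminus e -> v \notin Vminus e ->
  (forall D : {set V}, gamma_set e D -> ~ (u \in D /\ v \in D)) ->
  gamma e < gamma (add_path e u v (k := 2)).
Proof.
move=> uV vV nuv; rewrite ltnNge; apply/negP.
have [D /andP[/dominatingP domD /eqP <-]] := gamma_setP (add_path e u v (k := 2)) => leD.
pose D' : {set V} := [set x | inl x \in D].
have domD' (x : V) : [\/ dominated e D' x, x = u /\ inr ord0 \in D
                       | x = v /\ inr ord_max \in D].
  have [//||[[[|[|//]] lto] oD]] := dominated_add_path _ (domD (inl x)).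
  - by constructor 1.
  - by rewrite orbF => /= /eqP ->; constructor 2; split=> //; congr (inr _ \in D) : oD; apply: val_inj.
  - by move=> /= /eqP ->; constructor 3; split=> //; congr (inr _ \in D) : oD; apply: val_inj.
have cD : #|D| = #|D'| + (inr ord0 \in D) + (inr ord_max \in D).
  rewrite -sum1_card big_sumType /= [X in _ + X]big_mkcond /= 2!big_ord_recl big_ord0.
  rewrite sum1dep_card addn0 addnA (_ : lift ord0 ord0 = ord_max); last exact: val_inj.
  by case: (inr ord0 \in D); case: (inr ord_max \in D).
have [o0|o0] := boolP (inr ord0 \in D); have [o1|o1] := boolP (inr ord_max \in D).
(* Both path vertices lie in [D]: trading them for [u] saves one vertex and leaves only [v] possibly
   undominated. *)
- case/VminusP: vV; exists (u |: D').
    by rewrite cardsU1; move: leD; rewrite cD o0 o1; case: (u \notin D') => /=; lia.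
  move=> y yv; case: (domD' y) => [|[-> _]|[yE]].
  + by apply: dominated_sub; apply: subsetUr.
  + by apply/dominatedP; left; rewrite setU11.
  + by rewrite yE eqxx in yv.
- case/VminusP: uV; exists D'; first by lia.
  move=> y yu; case: (domD' y) => // -[yE]; first by rewrite yE eqxx in yu.
  by rewrite (negPf o1).
- case/VminusP: vV; exists D'; first by lia.
  move=> y yv; case: (domD' y) => // -[yE]; last by rewrite yE eqxx in yv.
  by rewrite (negPf o0).
(* No path vertex lies in [D], so $x_1$ can only be dominated by [u] and $x_2$ only by [v]. *)
- have gD' : gamma_set e D'.
    apply: dominating_gamma_set; last by lia.
    apply/dominatingP=> y; case: (domD' y) => // -[_]; first by rewrite (negPf o0).
    by rewrite (negPf o1).
  apply: (nuv D' gD').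
  have inr_adj (o : 'I_2) : inr o \notin D ->
      exists2 x, x \in D' & add_path e u v (inl x) (inr o).
    move=> oD; have /dominatedP := domD (inr o); rewrite (negPf oD) => -[//|[[x|o'] aD ao]].
      by exists x; rewrite ?inE.
    by case: o' aD {ao} => -[|[|//]] lto' aD; [case/negP: o0|case/negP: o1];
      congr (inr _ \in D) : aD; apply: val_inj.
  split.
    by have [x xD'] := inr_adj _ o0; rewrite add_path_inl_inr /= orbF => /eqP <-.
  by have [x xD'] := inr_adj _ o1; rewrite add_path_inl_inr /= => /eqP <-.
Qed.

Lemma pa_le (k : nat) : gamma e < gamma (add_path e u v (k := k)) -> pa e u v <= k.
Proof. by rewrite /pa; case: ex_minnP => m _; apply. Qed.

Lemma pa_le2P :
  pa e u v <= 2 <->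
  [/\ u \notin Vminus e, v \notin Vminus e
    & forall D : {set V}, gamma_set e D -> ~ (u \in D /\ v \in D)].
Proof.
split=> [|[uV vV nuv]]; last exact/pa_le/gamma_add_path2_gt.
(* The minimum [k] may be smaller than 2, so the obstructions have to apply to each [k <= 2]; adding
   an edge never raises [gamma], which excludes [k = 0]. *)
rewrite /pa; case: ex_minnP => k gt_k _ k2.
have k0 : 0 < k.
  by rewrite lt0n; apply: contraL gt_k => /eqP ->; rewrite -leqNgt gamma_add_edge_le.
suff [/norP[uV vV] nuv] : ~~ ((u \in Vminus e) || (v \in Vminus e)) /\
    forall D : {set V}, gamma_set e D -> ~ (u \in D /\ v \in D) by [].
split=> [|D gD [uD vD]].
  by apply: contraL gt_k => uvV; rewrite -leqNgt gamma_add_path_Vminus_le // k0.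
by move: gt_k; rewrite ltnNge (gamma_add_path_common_le _ gD).
Qed.

Lemma pa_ge2P : 2 <= pa e u v <-> gamma (add_path e u v (k := 1)) <= gamma e.
Proof.
split=> [lt1|le1]; first by rewrite leqNgt; apply/negP=> /pa_le; lia.
rewrite /pa; case: ex_minnP => -[|[|k]] // gt_k _.
  by have := gamma_add_edge_le; lia.
by lia.
Qed.

End PathAddition.

(** * Extremal values of [pa], and cliques *)

Section ExtremalPa.
Variables (V : finType) (e : rel V).

(** Noncompleteness rules out the default value 0 of [epa_bar]. *)
Lemma epa_bar_leP (m : nat) :
  noncomplete e ->
  epa_bar e <= m <-> exists u v : V, nonadjacent e u v /\ pa e u v <= m.
Proof.
move=> [a [b nab]]; rewrite /epa_bar; case: pickP => [p0 np0|/(_ (a, b))]; last first.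
  by rewrite nab.
case: arg_minnP => // -[u v] nuv minuv; split=> [le_m|[u' [v' [nuv' le_m]]]].
  by exists u, v.
exact: leq_trans (minuv (u', v') nuv') le_m.
Qed.

Lemma Epa_bar_leP (m : nat) :
  Epa_bar e <= m <-> forall u v : V, nonadjacent e u v -> pa e u v <= m.
Proof.
split=> [/bigmax_leqP le_m u v nuv|le_m]; first exact: (le_m (u, v)).
by apply/bigmax_leqP=> -[u v]; apply: le_m.
Qed.

Lemma pa_le_Epa_bar (u v : V) : nonadjacent e u v -> pa e u v <= Epa_bar e.
Proof. by move=> nuv; apply: (leq_bigmax_cond (u, v)). Qed.

Lemma undominated_nonadjacent (D : {set V}) (x y : V) :
  ~~ dominated e D x -> y \in D -> nonadjacent e y x.
Proof.
move=> /norP[xD nD] yD; apply/andP; split; first by apply: contraNneq xD => <-.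
by apply: contra nD => eyx; apply/exists_inP; exists y.
Qed.

(** Otherwise [x] lies in a $\gamma$-set whose other members, at least one in number, are
    nonadjacent to [x]. *)
Lemma clique_gamma_set_notin_Vminus (x : V) :
  2 <= gamma e -> (forall D : {set V}, gamma_set e D -> clique e D) ->
  x \notin Vminus e.
Proof.
move=> g2 cl; apply/negP=> /Vminus_gamma_set[D gD [cD ndx]].
have /card_gt0P[y yD] : 0 < #|D| by lia.
have /andP[yx /negP] := undominated_nonadjacent ndx yD; apply.
by apply: (cl _ gD) => //; rewrite !inE ?eqxx // yD orbT.
Qed.

(** If [gamma e <= 1], then at most one vertex dominates $G_{u,v,1}$. It is either $x_1$, forcing
    [V] to be the pair [u], [v], or a neighbour of $x_1$, hence [u] or [v]. Both cases make [u] or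
    [v] alone dominate the other, against nonadjacency. *)
Lemma gamma_ge2_of_pa_ge2 (u v : V) :
  symmetric e -> nonadjacent e u v -> 2 <= pa e u v -> 2 <= gamma e.
Proof.
move=> e_sym /andP[uv neuv] /pa_ge2P; rewrite ltnNge => le_g; apply/negP=> g1.
have undom (D : {set V}) (a : V) : (a == u) || (a == v) -> #|D| <= 1 -> a \in D ->
    dominated e D u -> dominated e D v -> False.
  move=> auv /card_le1_eqP D1 aD; have DE y : y \in D -> y = a by move=> yD; apply: D1.
  case/orP: auv => /eqP Ea; [move=> _|move=> + _] => /dominatedP[/DE|[y /DE ->]]; rewrite Ea.
  - by move/eqP; rewrite eq_sym (negPf uv).
  - by rewrite (negPf neuv).
  - by move/eqP; rewrite (negPf uv).
  - by rewrite e_sym (negPf neuv).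
have [F /andP[/dominatingP domF /eqP cF]] := gamma_setP (add_path e u v (k := 1)).
have F1 : #|F| <= 1 by lia.
pose F' : {set V} := [set x | inl x \in F].
have F'1 : #|F'| <= 1.
  by apply/card_le1_eqP=> x y; rewrite !inE => xF yF; have [] := card_le1_eqP F1 _ _ xF yF.
have [oF|oF] := boolP (inr ord0 \in F).
- have F'0 (x : V) : (x == u) || (x == v).
    have [//|/dominatedP[|[y]]|[o _]] := dominated_add_path _ (domF (inl x)).
    + by rewrite inE => xF; have := card_le1_eqP F1 _ _ xF oF.
    + by rewrite inE => yF; have := card_le1_eqP F1 _ _ yF oF.
    + by case/orP=> /andP[_ ->]; rewrite ?orbT.
  have [D /andP[/dominatingP domD /eqP cD]] := gamma_setP e.
  have D1 : #|D| <= 1 by rewrite cD.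
  case/dominatedP: (domD u) => [uD|[y yD _]].
    exact: (undom D u).
  exact: (undom D y).
- have domF' (x : V) : dominated e F' x.
    by have [//||[o]] := dominated_add_path _ (domF (inl x)) => //; rewrite ord1 (negPf oF).
  case/dominatedP: (domF (inr ord0)) => [|[[a|o] aF]]; first by rewrite (negPf oF).
    by rewrite add_path_inl_inr /= => auv; apply: (undom F' a); rewrite ?inE.
  by rewrite -(ord1 o) aF in oF.
Qed.

End ExtremalPa.

Theorem corollary15 (V : finType) (e : rel V)
    (e_sym : symmetric e) (e_irr : irreflexive e) (G_nc : noncomplete e) :
  (epa_bar e <= 2 <->
     exists u v : V,
       [/\ nonadjacent e u v, u \notin Vminus e, v \notin Vminus e
         & forall D : {set V}, gamma_set e D -> ~ (u \in D /\ v \in D)])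
  /\
  (Epa_bar e = 2 <->
     2 <= gamma e /\ (forall D : {set V}, gamma_set e D -> clique e D)).
Proof.
split.
  rewrite epa_bar_leP //; split=> -[u [v]].
    by case=> nuv /pa_le2P[uV vV nD]; exists u, v.
  by case=> nuv uV vV nD; exists u, v; split=> //; apply/pa_le2P.
split=> [E2|[g2 cl]].
  have le2 u v : nonadjacent e u v -> pa e u v <= 2 by apply: (Epa_bar_leP e 2).1; rewrite E2.
  have [u [v [nuv pa2]]] : exists u v, nonadjacent e u v /\ 2 <= pa e u v.
    case: (boolP [exists p : V * V, nonadjacent e p.1 p.2 && (2 <= pa e p.1 p.2)]).
      by case/existsP=> -[u v] /andP[]; exists u, v.
    move/existsPn=> no_pair; suff : Epa_bar e <= 1 by rewrite E2.
    apply/Epa_bar_leP=> u v nuv; have := no_pair (u, v); rewrite nuv /=; lia.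
  split; first exact: gamma_ge2_of_pa_ge2 e_sym nuv pa2.
  move=> D gD x y xD yD xy; apply/negPn/negP=> nexy.
  (* A nonadjacent pair inside a $\gamma$-set would have [pa] above 2. *)
  have /le2/pa_le2P[_ _ /(_ D gD)[]] // : nonadjacent e x y by rewrite /nonadjacent xy.
have nV := clique_gamma_set_notin_Vminus _ g2 cl.
apply/eqP; rewrite eqn_leq; apply/andP; split.
  apply/Epa_bar_leP=> u v /andP[uv /negP neuv]; apply/pa_le2P; split=> // D gD [uD vD].
  by apply: neuv; apply: (cl _ gD).
have [D gD] := gamma_setP e.
have cD : #|D| = gamma e by case/andP: gD => _ /eqP.
have /card_gt0P[x xD] : 0 < #|D| by lia.
(* Since [gamma e >= 2], the single vertex [x] misses some [y]; as [x] lies in a $\gamma$-set, this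
   pair has [pa] at least 2. *)
have [y ny] : exists y, ~~ dominated e [set x] y.
  apply/existsP; rewrite -negb_forall; apply/negP=> /gamma_le; rewrite cards1; lia.
have nxy := undominated_nonadjacent ny (set11 x).
apply: leq_trans (pa_le_Epa_bar nxy).
exact/pa_ge2P/(gamma_add_path1_le _ gD).
Qed.
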